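(* Let $V$ be a finite set with $n=|V|\ge 2$, let $d\colon V\times V\to\mathbb{R}$ be an ultrametric and $D=(d(x,y))_{x,y\in V}$. Let $m\coloneqq\min\{d(x,y): x\neq y\}$ and $M\coloneqq\max\{d(x,y): x\neq y\}$. Then the smallest eigenvalue $\lambda_n(D)$ of $D$ satisfies $$\lambda_n(D)\ge\begin{cases} n(m-M)/2-m & \text{if } n \text{ is even},\\ \big(nm-\sqrt{m^2+(n^2-1)M^2}\big)/2-m & \text{if } n\text{ is odd}.\end{cases}$$ This bound is attained if and only if there is a bipartition $V=V_1\cup V_2$ with $\big||V_1|-|V_2|\big|\le 1$ such that for all $x\neq y$, $d(x,y)=m$ if $(x,y)\in (V_1\times V_1)\cup(V_2\times V_2)$ and $d(x,y)=M$ if $(x,y)\in(V_1\times V_2)\cup(V_2\times V_1)$; equivalently, iff $D=X^*-mI$ for $X^*$ as defined below.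
   Context: An ultrametric on $V$ is a metric $d$ satisfying $d(x,z)\le\max\{d(x,y),d(y,z)\}$ for all $x,y,z$. For a bipartition $V=V_1\cup V_2$ with $\big||V_1|-|V_2|\big|\le 1$, $X^*$ is the $V\times V$ matrix with entries $m$ on $(V_1\times V_1)\cup(V_2\times V_2)$ (including the diagonal) and $M$ on $(V_1\times V_2)\cup(V_2\times V_1)$. $I$ is the identity matrix. *)

(* Defs.v *)
From mathcomp Require Import all_boot all_order all_algebra.
From mathcomp Require Import reals.

Set Implicit Arguments.
Unset Strict Implicit.
Unset Printing Implicit Defensive.

Import Order.TTheory GRing.Theory Num.Theory.
Local Open Scope ring_scope.

Record is_metric (R : realType) (V : Type) (d : V -> V -> R) : Prop := IsMetric {
  metric_ge0 : forall x y, 0 <= d x y;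
  metric_eq0 : forall x y, d x y = 0 <-> x = y;
  metric_sym : forall x y, d x y = d y x;
  metric_triangle : forall x y z, d x z <= d x y + d y z }.

Definition is_ultrametric (R : realType) (V : Type) (d : V -> V -> R) : Prop :=
  is_metric d /\ forall x y z, d x z <= Num.max (d x y) (d y z).

Definition is_min_dist (R : realType) (V : eqType) (d : V -> V -> R) (m : R) :
    Prop :=
  (exists x y, x != y /\ d x y = m) /\ (forall x y, x != y -> m <= d x y).

Definition is_max_dist (R : realType) (V : eqType) (d : V -> V -> R) (M : R) :
    Prop :=
  (exists x y, x != y /\ d x y = M) /\ (forall x y, x != y -> d x y <= M).

(* A V x V matrix is indexed by 'I_#|V| through the enumeration of V. *)
Definition mx_of_fun (R : realType) (V : finType) (f : V -> V -> R) :
    'M[R]_#|V| :=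
  \matrix_(i, j) f (enum_val i) (enum_val j).

Definition is_smallest_eigenvalue (R : realType) (n : nat) (A : 'M[R]_n)
    (l : R) : Prop :=
  eigenvalue A l /\ forall mu : R, eigenvalue A mu -> l <= mu.

Definition bipartition (V : finType) (V1 V2 : {set V}) : Prop :=
  V1 :|: V2 = [set: V] /\ V1 :&: V2 = set0.

Definition balanced (V : finType) (V1 V2 : {set V}) : Prop :=
  `|#|V1|%:Z - #|V2|%:Z| <= 1.

Definition same_part (V : finType) (V1 V2 : {set V}) (x y : V) : bool :=
  (x \in V1) && (y \in V1) || (x \in V2) && (y \in V2).

Definition cross_part (V : finType) (V1 V2 : {set V}) (x y : V) : bool :=
  (x \in V1) && (y \in V2) || (x \in V2) && (y \in V1).

(* For a bipartition (V1, V2), failing same_part amounts to cross_part. *)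
Definition Xstar (R : realType) (V : finType) (m M : R) (V1 V2 : {set V}) :
    'M[R]_#|V| :=
  mx_of_fun (fun x y => if same_part V1 V2 x y then m else M).

Definition eigenvalue_bound (R : realType) (n : nat) (m M : R) : R :=
  if odd n
  then (n%:R * m - Num.sqrt (m ^+ 2 + (n%:R ^+ 2 - 1) * M ^+ 2)) / 2 - m
  else n%:R * (m - M) / 2 - m.

(* Main.v *)
Require Import Defs.
From mathcomp Require Import all_boot all_order all_algebra.
From mathcomp Require Import reals.
From mathcomp Require Import complex polyrcf ring lra zify.

Set Implicit Arguments.
Unset Strict Implicit.
Unset Printing Implicit Defensive.

Import Order.TTheory GRing.Theory Num.Theory.
Local Open Scope ring_scope.

(** Put [X := D + m I], whose entries lie in [[m, M]], and let [f] be an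
    eigenvector of [D].  Splitting [V] into [P = {f >= 0}] and its complement,
    the form of [X] at [f] can only decrease when every entry inside a part is
    replaced by [m] and every entry across by [M]; the new form depends only on
    the sums [a], [c] of [f] over the two parts.  With [t := - (bound + m) >= 0]
    the form of [X + t I] at [f] becomes the sum of the replacement gap, of
    [t] times the two variances of [f] on the parts (Cauchy-Schwarz), and of a
    binary quadratic form in [a], [c] whose discriminant has the right sign
    because [t] is the root of
    [t^2 + n m t = floor (n^2/4) (M^2 - m^2)] and [#|P| * #|~: P| <= n^2/4].
    All three summands vanish in the equality case, which forces the balanced
    two-valued distance.  Existence of a real eigenvalue comes from the complex
    numbers. *)

(** * Real symmetric matrices have a smallest eigenvalue *)

(** With [w] the conjugate transpose of [v], associating [v *m A *m w] both ways gives [z] and its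
    conjugate times the same nonzero norm. *)
Lemma hermitian_eigenvalue_real (C : numClosedFieldType) (n : nat)
    (A : 'M[C]_n) (z : C) :
  (map_mx Num.conj A)^T = A -> eigenvalue A z -> z \is Num.real.
Proof.
move=> Aherm /eigenvalueP[v vA v0].
pose w := (map_mx Num.conj v)^T.
have Aw : A *m w = z^* *: w.
  rewrite /w -[in LHS]Aherm -trmx_mul -map_mxM vA.
  by apply/matrixP => i j; rewrite !mxE rmorphM.
have vw0 : (v *m w) 0 0 != 0.
  apply: contraNneq v0 => vw; apply/eqP/rowP => j.
  have {}vw : \sum_i `|v 0 i| ^+ 2 = 0.
    by rewrite -[RHS]vw mxE; apply: eq_bigr => i _; rewrite !mxE normCK.
  apply/eqP; rewrite mxE -normr_eq0 -sqrf_eq0; apply/eqP.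
  by apply: (psumr_eq0P _ vw) => // i _; exact: exprn_ge0.
apply/CrealP/(mulIf vw0); have := mulmxA v A w.
by rewrite vA Aw -scalemxAr -scalemxAl => /matrixP/(_ 0 0); rewrite !mxE.
Qed.

Lemma realsym_eigenvalue (R : rcfType) (n : nat) (A : 'M[R]_n) :
  (0 < n)%N -> A^T = A -> exists a, eigenvalue A a.
Proof.
move=> n0 Asym; pose B : 'M[R[i]]_n := map_mx (real_complex R) A.
have [z zB] := eigenvalue_closed B n0.
have zr : z \is Num.real.
  apply: hermitian_eigenvalue_real zB.
  apply/matrixP => i j; rewrite !mxE -[in RHS]Asym mxE.
  by apply: conj_Creal; rewrite complex_real.
exists (complex.Re z); rewrite -(eigenvalue_map (real_complex R)) /=.
by rewrite [real_complex R _](RRe_real zr).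
Qed.

(** The eigenvalues are the real roots of the characteristic polynomial, a finite list that is
    nonempty by the previous lemma. *)
Lemma realsym_smallest_eigenvalue (R : realType) (n : nat) (A : 'M[R]_n) :
  (0 < n)%N -> A^T = A -> exists l, is_smallest_eigenvalue A l.
Proof.
move=> n0 /(realsym_eigenvalue n0) [a].
have p0 : char_poly A != 0 by exact: monic_neq0 (char_poly_monic A).
have rE x : eigenvalue A x = (x \in rootsR (char_poly A)).
  by rewrite eigenvalue_root_char -(roots_on_rootsR p0) itv_boundlr.
rewrite rE => ar.
suff [l lr lmin] : exists2 l, l \in rootsR (char_poly A) &
    {in rootsR (char_poly A), forall mu, l <= mu}.
  by exists l; split=> [|mu]; rewrite rE //; exact: lmin.
elim: (rootsR _) a ar => {rE} // b [|c s] IH _ _.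
  by exists b => [|mu]; rewrite ?mem_head // inE => /eqP ->.
have [l ls lmin] := IH c (mem_head _ _).
case: (leP b l) => [bl|/ltW lb].
  exists b; first exact: mem_head.
  by move=> mu; rewrite in_cons => /predU1P[->//|/lmin]; exact: le_trans.
exists l; first by rewrite in_cons ls orbT.
by move=> mu; rewrite in_cons => /predU1P[->//|/lmin].
Qed.

(** * Eigenvectors as functions on [V], and sums over parts *)

Lemma eigenvalue_mx_of_funP (R : realType) (V : finType) (g : V -> V -> R)
    (a : R) :
  eigenvalue (mx_of_fun g) a <->
  exists2 f : V -> R, forall y, \sum_x f x * g x y = a * f y &
    exists x, f x != 0.
Proof.
have E F : \sum_(x : V) F x = \sum_(i < #|V|) F (enum_val i) :> R.
  by rewrite (reindex _ (onW_bij _ (@enum_val_bij V))).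
split=> [/eigenvalueP[v vg v0]|[f fg [x fx]]].
  exists (fun x => v 0 (enum_rank x)).
    move=> y; rewrite E.
    have /rowP/(_ (enum_rank y)) := vg; rewrite !mxE => <-.
    by apply: eq_bigr => i _; rewrite mxE enum_valK enum_rankK.
  have /rV0Pn[i vi] := v0.
  by exists (enum_val i); rewrite enum_valK.
apply/eigenvalueP; exists (\row_i f (enum_val i)).
  apply/rowP => j; rewrite !mxE -fg E.
  by apply: eq_bigr => i _; rewrite !mxE.
by apply/rV0Pn; exists (enum_rank x); rewrite mxE enum_rankK.
Qed.

Lemma sum_setC (R : nmodType) (V : finType) (A : {set V}) (F : V -> R) :
  \sum_x F x = \sum_(x in A) F x + \sum_(x in ~: A) F x.
Proof.
rewrite (bigID (mem A)) /=; congr +%R.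
by apply: eq_bigl => x; rewrite inE.
Qed.

Lemma sum_sqr_gt0 (R : realType) (V : finType) (f : V -> R) :
  (exists x, f x != 0) -> 0 < \sum_x f x ^+ 2.
Proof.
case=> x0 fx0; rewrite (bigD1 x0) //=.
rewrite ltr_pwDl ?sumr_ge0 // => [|? _]; last exact: sqr_ge0.
by rewrite lt0r sqrf_eq0 fx0 sqr_ge0.
Qed.

Lemma sum_parts_form (R : realType) (V : finType) (P : {set V}) (m M : R)
    (f : V -> R) :
  \sum_x \sum_y (if (x \in P) == (y \in P) then m else M) * (f x * f y) =
  m * ((\sum_(x in P) f x) ^+ 2 + (\sum_(x in ~: P) f x) ^+ 2) +
  2 * M * ((\sum_(x in P) f x) * (\sum_(x in ~: P) f x)).
Proof.
set a := \sum_(x in P) f x; set c := \sum_(x in ~: P) f x.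
rewrite (sum_setC P).
have -> : \sum_(x in P) \sum_y
      (if (x \in P) == (y \in P) then m else M) * (f x * f y) =
    \sum_(x in P) f x * (m * a + M * c).
  apply: eq_bigr => x xP; rewrite (sum_setC P) mulrDr !mulr_sumr xP; congr (_ + _).
    by apply: eq_bigr => y ->; rewrite eqxx; ring.
  by apply: eq_bigr => y; rewrite inE => /negPf ->; rewrite /=; ring.
have -> : \sum_(x in ~: P) \sum_y
      (if (x \in P) == (y \in P) then m else M) * (f x * f y) =
    \sum_(x in ~: P) f x * (M * a + m * c).
  apply: eq_bigr => x; rewrite inE => /negPf xP.
  rewrite (sum_setC P) mulrDr !mulr_sumr xP; congr (_ + _).
    by apply: eq_bigr => y ->; rewrite /=; ring.
  by apply: eq_bigr => y; rewrite inE => /negPf ->; rewrite /=; ring.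
by rewrite -!mulr_suml -/a -/c; ring.
Qed.

(** Cauchy-Schwarz with its defect made explicit; a zero defect means that [f] is constant on
    [P]. *)
Lemma sum_sqr_dev (R : realType) (V : finType) (P : {set V}) (f : V -> R) :
  (0 < #|P|)%N ->
  \sum_(x in P) (f x - (\sum_(x in P) f x) / #|P|%:R) ^+ 2 =
  \sum_(x in P) f x ^+ 2 - (\sum_(x in P) f x) ^+ 2 / #|P|%:R.
Proof.
move=> P0; set a := \sum_(x in P) f x.
have p0 : #|P|%:R != 0 :> R by rewrite pnatr_eq0 -lt0n.
under eq_bigr do rewrite sqrrB.
rewrite big_split /= sumrB sumr_const sumrMnl -mulr_suml -/a.
by rewrite -mulr_natl; field.
Qed.

(** * The binary form, the root [t], and nearly equal part sizes *)

(** Multiplying the form by [A] completes the square. *)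
Lemma binary_form (R : realType) (A B M a c : R) :
  0 < A -> M ^+ 2 <= A * B ->
  0 <= A * a ^+ 2 + 2 * M * (a * c) + B * c ^+ 2 /\
  (A * a ^+ 2 + 2 * M * (a * c) + B * c ^+ 2 = 0 ->
    A * a + M * c = 0 /\ (A * B - M ^+ 2) * c ^+ 2 = 0).
Proof.
move=> A0 MAB.
have E : A * (A * a ^+ 2 + 2 * M * (a * c) + B * c ^+ 2) =
  (A * a + M * c) ^+ 2 + (A * B - M ^+ 2) * c ^+ 2 by ring.
have h1 : 0 <= (A * a + M * c) ^+ 2 by exact: sqr_ge0.
have h2 : 0 <= (A * B - M ^+ 2) * c ^+ 2.
  by rewrite mulr_ge0 ?sqr_ge0 ?subr_ge0.
split; first by rewrite -(pmulr_rge0 _ A0) E addr_ge0.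
move=> q0; move/esym/eqP: E; rewrite q0 mulr0 paddr_eq0 // sqrf_eq0.
by case/andP=> /eqP ? /eqP.
Qed.

(** The factor [(n%:R ^+ 2 - (odd n)%:R) / 4] is floor(n^2/4), which treats both parities by one
    equation. *)
Lemma bound_root (R : realType) (n : nat) (m M t : R) :
  (0 < n)%N -> 0 < m -> m <= M -> t = - (eigenvalue_bound n m M + m) ->
  0 <= t /\
  t ^+ 2 + t * m * n%:R = (n%:R ^+ 2 - (odd n)%:R) / 4 * (M ^+ 2 - m ^+ 2).
Proof.
move=> n0 m0 mM ->; rewrite /eigenvalue_bound.
have n1 : 1 <= n%:R :> R by rewrite ler1n.
have MM : m ^+ 2 <= M ^+ 2 by rewrite ler_sqr ?nnegrE //; lra.
have nn : 1 <= n%:R ^+ 2 :> R by rewrite expr_ge1 // ler0n.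
have key : 0 <= (n%:R ^+ 2 - 1) * (M ^+ 2 - m ^+ 2).
  by rewrite mulr_ge0 // subr_ge0.
case: odd => /=; last by split; [nra|field].
set s := Num.sqrt _.
have s0 : 0 <= s by exact: sqrtr_ge0.
have s2 : s ^+ 2 = m ^+ 2 + (n%:R ^+ 2 - 1) * M ^+ 2.
  by rewrite sqr_sqrtr // addr_ge0 ?sqr_ge0 // mulr_ge0 ?sqr_ge0 ?subr_ge0.
have sn : n%:R * m <= s.
  rewrite -ler_sqr ?nnegrE ?s2 ?mulr_ge0 ?ler0n ?(ltW m0) //.
  by rewrite exprMn; lra.
split; first by lra.
(* Here t = (s - nm)/2, so t (t + nm) is a difference of squares over 4. *)
transitivity ((s ^+ 2 - n%:R ^+ 2 * m ^+ 2) / 4); first by field.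
by rewrite s2; field.
Qed.

(** An odd sum excludes p = q. As 4pq = (p + q)^2 - (p - q)^2, this says that pq is at most
    floor(n^2/4) for n = p + q. *)
Lemma odd_le_sqr_diff (R : realType) (p q : nat) :
  (odd (p + q))%:R <= (p%:R - q%:R) ^+ 2 :> R.
Proof.
wlog qp : p q / (q <= p)%N.
  by case: (leqP q p) => [|/ltnW] h /(_ _ _ h) //; rewrite addnC -sqrrN opprB.
rewrite -natrB // -natrX ler_nat -(subnK qp) -addnA oddD oddD addbb addbF.
rewrite addnK; case: (p - q)%N => // k.
by apply: leq_trans (leq_b1 _) _; rewrite expn_gt0.
Qed.

Lemma balanced_sqr_diff (R : realType) (V : finType) (V1 V2 : {set V}) :
  balanced V1 V2 <->
  (#|V1|%:R - #|V2|%:R) ^+ 2 = (odd (#|V1| + #|V2|))%:R :> R.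
Proof.
rewrite /balanced; move: #|V1| #|V2| => p q.
wlog qp : p q / (q <= p)%N.
  case: (leqP q p) => [|/ltnW] h /(_ _ _ h) //.
  by rewrite addnC -sqrrN opprB distrC.
have E : (p%:R - q%:R) ^+ 2 = ((p - q) ^ 2)%:R :> R by rewrite -natrB // natrX.
have oE : odd (p + q) = odd (p - q).
  by rewrite -{1}(subnK qp) -addnA oddD oddD addbb addbF.
rewrite E oE; split=> [pq|/eqP].
  have : (p - q <= 1)%N by lia.
  by case: (p - q)%N => [|[]].
rewrite eqr_nat => /eqP h.
have : ((p - q) ^ 2 <= 1)%N by rewrite h leq_b1.
case k : (p - q)%N => [|[|j]] // _; lia.
Qed.

(** * The lower bound for the quadratic form and its equality case *)

Lemma form_bound (R : realType) (V : finType) (m M t : R) (X : V -> V -> R)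
    (f : V -> R) (P := [set x | 0 <= f x]) :
  0 < m -> m <= M -> 0 <= t ->
  t ^+ 2 + t * m * #|V|%:R =
    (#|V|%:R ^+ 2 - (odd #|V|)%:R) / 4 * (M ^+ 2 - m ^+ 2) ->
  (forall x y, m <= X x y <= M) -> (exists x, f x != 0) ->
  let S := \sum_x \sum_y X x y * (f x * f y) + t * \sum_x f x ^+ 2 in
  0 <= S /\
  (S = 0 -> 0 < t -> m < M ->
    balanced P (~: P) /\
    forall x y, X x y = if (x \in P) == (y \in P) then m else M).
Proof.
move=> m0 mM t0 tE Xb [x0 fx0].
pose Y x y := if (x \in P) == (y \in P) then m else M.
pose G := \sum_x \sum_y (X x y - Y x y) * (f x * f y).
(* Inside a part [f x * f y] is nonnegative and [X x y >= m]; across, the product is nonpositive and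
   [X x y <= M]. *)
have gap x y : 0 <= (X x y - Y x y) * (f x * f y).
  have /andP[mX XM] := Xb x y; rewrite /Y !inE.
  case: (lerP 0 (f x)) => fx; case: (lerP 0 (f y)) => fy /=.
  - by rewrite mulr_ge0 ?mulr_ge0 // subr_ge0.
  - by rewrite mulr_le0 ?subr_le0 // mulr_ge0_le0 // ltW.
  - by rewrite mulr_le0 ?subr_le0 // mulr_le0_ge0 // ltW.
  - by rewrite mulr_ge0 ?subr_ge0 // mulr_le0 // ltW.
have G0 : 0 <= G by do 2!apply: sumr_ge0 => ? _.
set a := \sum_(x in P) f x; set c := \sum_(x in ~: P) f x.
have QE : \sum_x \sum_y X x y * (f x * f y) =
    G + (m * (a ^+ 2 + c ^+ 2) + 2 * M * (a * c)).
  rewrite -sum_parts_form -big_split; apply: eq_bigr => x _ /=.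
  by rewrite -big_split; apply: eq_bigr => y _ /=; rewrite /Y; ring.
have S0 := sum_sqr_gt0 (ex_intro _ x0 fx0).
rewrite /= QE.
have VPP : #|V| = (#|P| + #|~: P|)%N by rewrite cardsC.
(* With an empty part the cross term disappears; the form is nonnegative, and positive once
   [t > 0]. *)
have [P0|p0] := posnP #|P|; last have [P0|q0] := posnP #|~: P|.
- have a0 : a = 0 by rewrite /a (cards0_eq P0) big_set0.
  rewrite a0; split=> [|+ t1]; have := mulr_ge0 t0 (ltW S0); have := sqr_ge0 c.
    nra.
  by have := mulr_gt0 t1 S0; nra.
- have c0 : c = 0 by rewrite /c (cards0_eq P0) big_set0.
  rewrite c0; split=> [|+ t1]; have := mulr_ge0 t0 (ltW S0); have := sqr_ge0 a.
    nra.
  by have := mulr_gt0 t1 S0; nra.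
pose p : R := #|P|%:R; pose q : R := #|~: P|%:R.
have p1 : 0 < p by rewrite ltr0n.
have q1 : 0 < q by rewrite ltr0n.
have A0 : 0 < m + t / p by rewrite ltr_pwDl // divr_ge0 // ltW.
(* Expand, substitute [tE] for the terms in [t], and use n^2 = (p - q)^2 + 4pq. *)
have disc : (m + t / p) * (m + t / q) - M ^+ 2 =
    ((p - q) ^+ 2 - (odd #|V|)%:R) / (4 * p * q) * (M ^+ 2 - m ^+ 2).
  transitivity ((t ^+ 2 + t * m * #|V|%:R) / (p * q) + m ^+ 2 - M ^+ 2).
    by rewrite VPP natrD -/p -/q; field; rewrite !gt_eqF.
  by rewrite tE VPP natrD -/p -/q; field; rewrite !gt_eqF.
have oddle : 0 <= (p - q) ^+ 2 - (odd #|V|)%:R.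
  by rewrite subr_ge0 VPP odd_le_sqr_diff.
have MM : m ^+ 2 <= M ^+ 2 by rewrite ler_sqr ?nnegrE //; lra.
have disc0 : M ^+ 2 <= (m + t / p) * (m + t / q).
  rewrite -subr_ge0 disc mulr_ge0 ?[0 <= M ^+ 2 - _]subr_ge0 // divr_ge0 //.
  by rewrite ltW // !mulr_gt0.
have [B0 Beq] := binary_form a c A0 disc0.
pose vP := \sum_(x in P) (f x - a / p) ^+ 2.
pose vN := \sum_(x in ~: P) (f x - c / q) ^+ 2.
have vP0 : 0 <= vP by apply: sumr_ge0 => ? _; exact: sqr_ge0.
have vN0 : 0 <= vN by apply: sumr_ge0 => ? _; exact: sqr_ge0.
set B := _ + (m + t / q) * _ in B0 Beq.
(* Splitting [t] times the sum of squares into variances leaves t a^2/p and t c^2/q, the corrections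
   to [m] in [B]. *)
have SE : G + (m * (a ^+ 2 + c ^+ 2) + 2 * M * (a * c)) + t * \sum_x f x ^+ 2
    = G + t * vP + t * vN + B.
  rewrite (sum_setC P) /vP /vN !sum_sqr_dev // -/a -/c -/p -/q /B; field.
  by rewrite !gt_eqF.
have tP : 0 <= t * vP by rewrite mulr_ge0.
have tN : 0 <= t * vN by rewrite mulr_ge0.
clearbody B; rewrite SE; split; first by rewrite !addr_ge0.
move=> S00 t1 mltM.
have /eqP : t * vP = 0 by lra.
rewrite mulf_eq0 gt_eqF //= => /eqP vP00.
have /eqP : t * vN = 0 by lra.
rewrite mulf_eq0 gt_eqF //= => /eqP vN00.
have G00 : G = 0 by lra.
have B00 : B = 0 by lra.
have [Aa disc00] := Beq B00.
have fP x : x \in P -> f x = a / p.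
  move=> xP; apply/eqP; rewrite -subr_eq0 -sqrf_eq0; apply/eqP.
  by apply: (psumr_eq0P _ vP00) xP => y _; exact: sqr_ge0.
have fN x : x \in ~: P -> f x = c / q.
  move=> xP; apply/eqP; rewrite -subr_eq0 -sqrf_eq0; apply/eqP.
  by apply: (psumr_eq0P _ vN00) xP => y _; exact: sqr_ge0.
(* If [c] vanished, so would [a], and then [f], which is constant on each part. *)
have c0 : c != 0.
  apply: contraNneq fx0 => c0; move/eqP: Aa.
  rewrite c0 mulr0 addr0 mulf_eq0 gt_eqF //= => /eqP a0.
  have [/fP ->|xP] := boolP (x0 \in P); first by rewrite a0 mul0r.
  by rewrite fN ?in_setC // c0 mul0r.
have a0 : a != 0.
  apply: contraNneq c0 => a0; move/eqP: Aa.
  by rewrite a0 mulr0 add0r mulf_eq0 gt_eqF //; lra.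
have f0 x : f x != 0.
  have [/fP ->|xP] := boolP (x \in P).
    by rewrite mulf_neq0 // invr_neq0 // gt_eqF.
  by rewrite fN ?in_setC // mulf_neq0 // invr_neq0 // gt_eqF.
split.
  (* Since [c] is nonzero the discriminant vanishes, and [m < M] leaves only the factor in p - q. *)
  apply/(balanced_sqr_diff R); rewrite -VPP -/p -/q; apply/eqP.
  rewrite -subr_eq0; have /eqP := disc00; rewrite disc !mulf_eq0 invr_eq0 !mulf_eq0.
  rewrite ?(negPf c0) !(gt_eqF p1) !(gt_eqF q1) pnatr_eq0 /= !orbF.
  case/orP=> // /eqP MM0; have : 0 < (M - m) * (M + m) by rewrite mulr_gt0; lra.
  by rewrite -subr_sqr MM0 ltxx.
(* Each gap term is zero and [f] has no zero, so [X] and [Y] agree entrywise. *)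
move=> x y; apply/eqP; rewrite -subr_eq0.
have Gx : \sum_y (X x y - Y x y) * (f x * f y) = 0.
  by apply: (psumr_eq0P _ G00) => // z _; apply: sumr_ge0 => ? _.
have /eqP : (X x y - Y x y) * (f x * f y) = 0 by exact: (psumr_eq0P _ Gx).
by rewrite !mulf_eq0 !(negPf (f0 _)) !orbF.
Qed.

(** * Bipartitions and the extremal matrix *)

Lemma bipartition_setC (V : finType) (V1 V2 : {set V}) :
  bipartition V1 V2 -> V2 = ~: V1.
Proof.
case=> U I; apply/setP => x.
have := in_setT x; rewrite -U !inE => + .
have := in_set0 x; rewrite -I !inE.
by case: (x \in V1); case: (x \in V2).
Qed.

Lemma setC_bipartition (V : finType) (A : {set V}) : bipartition A (~: A).
Proof. by split; rewrite ?setUCr ?setICr. Qed.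

Lemma same_part_setC (V : finType) (A : {set V}) (x y : V) :
  same_part A (~: A) x y = ((x \in A) == (y \in A)).
Proof. by rewrite /same_part !inE; case: (x \in A); case: (y \in A). Qed.

Lemma cross_part_setC (V : finType) (A : {set V}) (x y : V) :
  cross_part A (~: A) x y = ((x \in A) != (y \in A)).
Proof. by rewrite /cross_part !inE; case: (x \in A); case: (y \in A). Qed.

Lemma two_valued_mxE (R : realType) (V : finType) (d : V -> V -> R) (m M : R)
    (V1 V2 : {set V}) :
  (forall x, d x x = 0) -> bipartition V1 V2 ->
  (forall x y : V, x != y ->
    (same_part V1 V2 x y -> d x y = m) /\
    (cross_part V1 V2 x y -> d x y = M)) <->
  mx_of_fun d = Xstar m M V1 V2 - m%:M.
Proof.
move=> d0 /bipartition_setC ->; split=> [H|H x y xy].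
  apply/matrixP => i j; rewrite !mxE same_part_setC.
  have [->|ij] := eqVneq i j; first by rewrite eqxx d0 mulr1n subrr.
  rewrite mulr0n subr0.
  have [|s c] := H (enum_val i) (enum_val j).
    by rewrite (inj_eq enum_val_inj).
  rewrite same_part_setC in s; rewrite cross_part_setC in c.
  by case: ifP => [/s|/negbT/c].
move/matrixP/(_ (enum_rank x) (enum_rank y)): H.
rewrite !mxE !enum_rankK (inj_eq enum_rank_inj) (negPf xy) mulr0n subr0 => ->.
by rewrite same_part_setC cross_part_setC; split; [move=> -> | move/negPf ->].
Qed.

Lemma Xstar_eigenvalue (R : realType) (V : finType) (m M t : R)
    (A : {set V}) :
  (2 <= #|V|)%N -> 0 < m -> m <= M -> 0 <= t ->
  t ^+ 2 + t * m * #|V|%:R =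
    (#|V|%:R ^+ 2 - (odd #|V|)%:R) / 4 * (M ^+ 2 - m ^+ 2) ->
  balanced A (~: A) ->
  eigenvalue (Xstar m M A (~: A) - m%:M) (- t - m).
Proof.
move=> V2 m0 mM t0 tE bal.
have VAA : #|V| = (#|A| + #|~: A|)%N by rewrite cardsC.
pose p : R := #|A|%:R; pose q : R := #|~: A|%:R.
have tpq : t ^+ 2 + t * m * (p + q) = p * q * (M ^+ 2 - m ^+ 2).
  have := tE; rewrite VAA -(balanced_sqr_diff R A (~: A)).1 // natrD -/p -/q.
  by move=> ->; field.
have -> : Xstar m M A (~: A) - m%:M = mx_of_fun (fun x y : V =>
    (if (x \in A) == (y \in A) then m else M) - m *+ (x == y)).
  apply/matrixP => i j; rewrite !mxE same_part_setC.
  by rewrite (inj_eq enum_val_inj).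
apply/eigenvalue_mx_of_funP.
(* These values solve the eigenvector equation on [A] identically; on the complement it becomes
   [tpq]. *)
pose f x := if x \in A then M * q else - (m * p + t).
have [p1 q1] : (0 < #|A| /\ 0 < #|~: A|)%N.
  by move: bal; rewrite /balanced; lia.
exists f => [y|].
  under eq_bigr do rewrite mulrBr.
  rewrite sumrB.
  have -> : \sum_x f x * (m *+ (x == y)) = f y * m.
    rewrite (bigD1 y) //= eqxx mulr1n big1 ?addr0 // => x /negPf ->.
    by rewrite mulr0n mulr0.
  rewrite (sum_setC A).
  have -> : \sum_(x in A) f x * (if (x \in A) == (y \in A) then m else M) =
      p * (M * q * (if y \in A then m else M)).
    rewrite [RHS]mulr_natl -sumr_const; apply: eq_bigr => x xA.
    by rewrite /f xA; case: (y \in A).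
  have -> : \sum_(x in ~: A) f x * (if (x \in A) == (y \in A) then m else M) =
      q * (- (m * p + t) * (if y \in A then M else m)).
    rewrite [RHS]mulr_natl -sumr_const; apply: eq_bigr => x.
    by rewrite inE /f => /negPf ->; case: (y \in A).
  rewrite /f; case: (y \in A); first by ring.
  apply/eqP; rewrite -subr_eq0 -(subrr (t ^+ 2 + t * m * (p + q))); apply/eqP.
  by rewrite {1}tpq; ring.
have /card_gt0P[x xA] := p1.
by exists x; rewrite /f xA mulf_neq0 ?pnatr_eq0 -?lt0n // gt_eqF //; lra.
Qed.

(** Supplies the bipartition when [m = M]. *)
Lemma exists_balanced (V : finType) : exists A : {set V}, balanced A (~: A).
Proof.
have : (0 < #|[set A : {set V} | A \subset setT & #|A| == #|V|./2]|)%N.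
  by rewrite cards_draws bin_gt0 cardsT; have := odd_double_half #|V|; lia.
case/card_gt0P=> A; rewrite inE => /andP[_ /eqP cA]; exists A.
have := cardsC A; rewrite /balanced cA; have := odd_double_half #|V|.
by lia.
Qed.

(** * The bound and both characterisations of equality *)

Theorem theorem11 (R : realType) (V : finType) (d : V -> V -> R) (m M : R)
    (hV : (2 <= #|V|)%N) (hd : is_ultrametric d)
    (hm : is_min_dist d m) (hM : is_max_dist d M) :
  exists lambda : R,
    [/\ is_smallest_eigenvalue (mx_of_fun d) lambda,
        eigenvalue_bound #|V| m M <= lambda,
        lambda = eigenvalue_bound #|V| m M <->
          (exists V1 V2 : {set V},
            [/\ bipartition V1 V2, balanced V1 V2 &
                forall x y : V, x != y ->
                  (same_part V1 V2 x y -> d x y = m) /\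
                  (cross_part V1 V2 x y -> d x y = M)]) &
        lambda = eigenvalue_bound #|V| m M <->
          (exists V1 V2 : {set V},
            [/\ bipartition V1 V2, balanced V1 V2 &
                mx_of_fun d = Xstar m M V1 V2 - m%:M])].
Proof.
have [[d_ge0 d_eq0 d_sym _] _] := hd.
have [[x1 [y1 [xy1 dm]]] m_le] := hm; have [_ le_M] := hM.
have d0 x : d x x = 0 by exact/d_eq0.
have m0 : 0 < m.
  rewrite lt0r -dm d_ge0 andbT; apply: contra xy1.
  by move=> /eqP/d_eq0 ->.
have mM : m <= M by rewrite -dm le_M.
have n0 : (0 < #|V|)%N by apply: leq_trans hV.
set beta := eigenvalue_bound _ _ _.
pose t := - (beta + m).
have [t0 tE] := bound_root n0 m0 mM (erefl t).
have betaE : beta = - t - m by rewrite /t; ring.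
have [||l lmin] := @realsym_smallest_eigenvalue R #|V| (mx_of_fun d).
- by [].
- by apply/matrixP => i j; rewrite !mxE.
exists l.
have [/eigenvalue_mx_of_funP[f fl f0] lle] := lmin.
(* Filling the diagonal with [m] puts every entry in [m, M]. *)
pose X x y := d x y + m *+ (x == y).
have Xb x y : m <= X x y <= M.
  rewrite /X; have [->|xy] := eqVneq x y; first by rewrite d0 add0r lexx.
  by rewrite addr0 m_le ?le_M.
have [+ Seq] := form_bound m0 mM t0 tE Xb f0.
(* X + t I equals D - beta I, and [f] is an eigenvector of D for [l]. *)
have SE : \sum_x \sum_y X x y * (f x * f y) + t * \sum_x f x ^+ 2 =
    (l - beta) * \sum_x f x ^+ 2.
  rewrite exchange_big /= !mulr_sumr -big_split; apply: eq_bigr => y _ /=.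
  transitivity ((\sum_x f x * d x y) * f y + m * f y ^+ 2 + t * f y ^+ 2);
    last by rewrite fl betaE; ring.
  congr (_ + _); rewrite mulr_suml.
  under eq_bigr do rewrite /X mulrDl.
  rewrite big_split /=; congr (_ + _).
    by apply: eq_bigr => x _; ring.
  rewrite (bigD1 y) //= eqxx mulr1n big1 ?addr0 ?expr2 // => x /negPf ->.
  by rewrite mulr0n mul0r.
rewrite SE pmulr_lge0 ?sum_sqr_gt0 // subr_ge0 => betal.
have fwd : l = beta -> exists V1 V2 : {set V},
    [/\ bipartition V1 V2, balanced V1 V2 &
        mx_of_fun d = Xstar m M V1 V2 - m%:M].
  move=> lb; have [mltM|] := ltP m M; last first.
    move=> Mm; have [A balA] := exists_balanced V.
    exists A, (~: A); split=> //; first exact: setC_bipartition.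
    apply/two_valued_mxE => // [|x y xy]; first exact: setC_bipartition.
    have dxy : d x y = m.
      by apply/le_anti; rewrite m_le // (le_trans (le_M _ _ xy)).
    by rewrite dxy; split=> // _; apply/le_anti; rewrite mM Mm.
  (* If [t = 0], then [tE] gives M^2 = m^2, because floor(n^2/4) is positive for n at least 2. *)
  have t1 : 0 < t.
    rewrite lt0r t0 andbT; apply: contraTN mltM => t00.
    have n2 : 2 <= #|V|%:R :> R by rewrite ler_nat.
    have odd1 : (odd #|V|)%:R <= 1 :> R by rewrite lern1 leq_b1.
    have odd_lt : 0 < (#|V|%:R ^+ 2 - (odd #|V|)%:R) / 4 :> R by nra.
    have tz : t = 0 by exact/eqP.
    have /esym/eqP := tE; rewrite tz expr0n !mul0r addr0 mulf_eq0 gt_eqF //=.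
    by rewrite subr_eq0 eqrXn2 //; [move/eqP->; rewrite ltxx | lra | lra].
  have [|bal XE] := Seq _ t1 mltM; first by rewrite SE lb subrr mul0r.
  eexists _, _; split; [exact: setC_bipartition | exact: bal |].
  apply/two_valued_mxE => // [|x y xy]; first exact: setC_bipartition.
  have := XE x y; rewrite /X (negPf xy) addr0 => ->.
  by rewrite same_part_setC cross_part_setC; split; [move=> -> | move/negPf ->].
(* The explicit eigenvector makes [beta] an eigenvalue, so minimality of [l] gives the inequality
   opposite to [betal]. *)
have bwd (V1 V2 : {set V}) : bipartition V1 V2 -> balanced V1 V2 ->
    mx_of_fun d = Xstar m M V1 V2 - m%:M -> l = beta.
  move=> /bipartition_setC -> bal dE; apply/le_anti; rewrite betal andbT.
  by apply: lle; rewrite dE betaE; exact: Xstar_eigenvalue tE bal.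
split=> //; split.
- move=> /fwd[V1 [V2 [bip bal dE]]]; exists V1, V2; split=> //.
  exact/(two_valued_mxE _ _ d0 bip).
- move=> [V1 [V2 [bip bal dE]]]; apply: (bwd V1 V2) => //.
  exact/(two_valued_mxE _ _ d0 bip).
- exact: fwd.
- by move=> [V1 [V2 [bip bal dE]]]; exact: (bwd V1 V2).
Qed.
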